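(* For all $(u,v)\in [0,1]^2$ put $P(u,v)=(u-v)\min(u,v)\min(1-u,1-v)$. Then the mapping $$C(u,v)=uv+P(u,v)=uv+(u-v)\min(u,v)\min(1-u,1-v),\qquad (u,v)\in[0,1]^2,$$ defines a copula.
   Context: A (bivariate) copula is a function $C:[0,1]^2\to[0,1]$ such that, for all $u,v\in[0,1]$: (1) $C(0,v)=C(u,0)=0$; (2) $C(1,v)=v$ and $C(u,1)=u$; (3) for every rectangle $[u_1,u_2]\times[v_1,v_2]\subset[0,1]^2$ with $u_1<u_2$ and $v_1<v_2$, $C(u_2,v_2)-C(u_2,v_1)-C(u_1,v_2)+C(u_1,v_1)\ge 0$. *)

(* Defs.v *)
From mathcomp Require Import all_boot all_order all_algebra.
From mathcomp Require Import reals.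

Set Implicit Arguments.
Unset Strict Implicit.
Unset Printing Implicit Defensive.

Import Order.TTheory GRing.Theory Num.Theory.
Local Open Scope ring_scope.

(* A function on the unit square is represented by a total function on R x R;
   the predicate below constrains its values on the unit square only. *)
Record is_copula (R : realType) (C : R -> R -> R) : Prop := IsCopula {
  copula_range : forall u v : R,
    u \in `[0, 1] -> v \in `[0, 1] -> C u v \in `[0, 1];
  copula_grounded : forall u v : R,
    u \in `[0, 1] -> v \in `[0, 1] -> C 0 v = 0 /\ C u 0 = 0;
  copula_margins : forall u v : R,
    u \in `[0, 1] -> v \in `[0, 1] -> C 1 v = v /\ C u 1 = u;
  copula_2increasing : forall u1 u2 v1 v2 : R,
    u1 \in `[0, 1] -> u2 \in `[0, 1] -> v1 \in `[0, 1] -> v2 \in `[0, 1] ->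
    u1 < u2 -> v1 < v2 ->
    0 <= C u2 v2 - C u2 v1 - C u1 v2 + C u1 v1
}.

Definition perturbation (R : realType) (u v : R) : R :=
  (u - v) * Num.min u v * Num.min (1 - u) (1 - v).

(* Main.v *)
Require Import Defs.
From mathcomp Require Import all_boot all_order all_algebra.
From mathcomp Require Import reals.
From mathcomp Require Import ring lra.

Set Implicit Arguments.
Unset Strict Implicit.
Unset Printing Implicit Defensive.

Import Order.TTheory GRing.Theory Num.Theory.
Local Open Scope ring_scope.

(** For v <= w the map t |-> C(t, w) - C(t, v) is a quadratic polynomial on each
    of [0, v], [v, w] and [w, 1].  Its increment between s <= t is (t - s) times,
    respectively, (w - v) (v + w - s - t), at least (w - v)^2, and
    (w - v) (2 - s - t + v + w), so it is nondecreasing on [0, 1], which is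
    2-increasingness.  The bounds 0 <= C(u, v) <= v follow from the rectangles
    [0, u] x [0, v] and [u, 1] x [0, v]. *)

Lemma nondecreasing_glue (R : realDomainType) (f : R -> R) (a b c : R) :
    (forall s t, a <= s -> s <= t -> t <= b -> f s <= f t) ->
    (forall s t, b <= s -> s <= t -> t <= c -> f s <= f t) ->
  forall s t, a <= s -> s <= t -> t <= c -> f s <= f t.
Proof.
move=> fab fbc s t as_ st tc.
have [tb|/ltW bt] := leP t b; first exact: fab.
have [bs|/ltW sb] := leP b s; first exact: fbc.
by apply: (@le_trans _ _ (f b)); [exact: fab | exact: fbc].
Qed.

Section Copula.
Variable R : realType.
Implicit Types s t u v w : R.

Let C u v := u * v + perturbation u v.

(** For [u <= v] the minima are [u] and [1 - v], so the perturbation is [(u - v) * u * (1 - v)],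
    whose expansion cancels [u * v]. *)
Lemma copula_above_diagonal u v :
  u <= v -> C u v = u ^+ 2 - u ^+ 2 * v + u * v ^+ 2.
Proof.
move=> uv; rewrite /C /perturbation (min_idPl uv) (min_idPr _); last by lra.
by ring.
Qed.

Lemma copula_below_diagonal u v :
  v <= u -> C u v = 2 * u * v - v ^+ 2 - u ^+ 2 * v + u * v ^+ 2.
Proof.
move=> vu; rewrite /C /perturbation (min_idPr vu) (min_idPl _); last by lra.
by ring.
Qed.

Lemma copula_section_nondecreasing v w s t :
    0 <= v -> v <= w -> w <= 1 -> 0 <= s -> s <= t -> t <= 1 ->
  C s w - C s v <= C t w - C t v.
Proof.
move=> v0 vw w1; move: s t; apply: (@nondecreasing_glue _ _ _ v).
  move=> s t s0 st tv; rewrite !copula_above_diagonal; try lra.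
  rewrite -subr_ge0.
  rewrite (_ : _ - _ = (t - s) * ((w - v) * (v + w - s - t))); last by ring.
  by rewrite !mulr_ge0//; lra.
apply: (@nondecreasing_glue _ _ _ w) => s t.
  move=> vs st tw.
  (* Between [v] and [w] the two branches mix: points at height [w] lie on or above the diagonal,
     those at height [v] on or below it. *)
  rewrite !(@copula_above_diagonal _ w) ?(@copula_below_diagonal _ v); try lra.
  rewrite -subr_ge0.
  (* Centring [s] and [t] at [v] completes a square in [w - v]; the remaining product is nonnegative
     because [w - v <= 1]. *)
  rewrite (_ : _ - _ = (t - s) *
    ((w - v) ^+ 2 + ((t - v) + (s - v)) * (1 - w + v))); last by ring.
  rewrite mulr_ge0 ?subr_ge0//.
  by rewrite (addr_ge0 (sqr_ge0 _))// mulr_ge0//; lra.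
move=> ws st t1; rewrite !copula_below_diagonal; try lra.
rewrite -subr_ge0.
rewrite (_ : _ - _ = (t - s) * ((w - v) * (2 - s - t + v + w))); last by ring.
by rewrite !mulr_ge0//; lra.
Qed.

(** Each edge of the square lies on one side of the diagonal, left and top above, bottom and right
    below, so a single polynomial settles it. *)
Lemma copula_grounded_margins u : 0 <= u <= 1 ->
  [/\ C 0 u = 0, C u 0 = 0, C 1 u = u & C u 1 = u].
Proof.
case/andP=> u0 u1; split.
- by rewrite copula_above_diagonal//; ring.
- by rewrite copula_below_diagonal//; ring.
- by rewrite copula_below_diagonal//; ring.
- by rewrite copula_above_diagonal//; ring.
Qed.

End Copula.

Theorem theorem10 (R : realType) :
  is_copula (fun u v : R => u * v + perturbation u v).
Proof.
split=> [u v|u v|u v|u1 u2 v1 v2]; rewrite !in_itv /=.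
- move=> hu hv; have [u0 u1] := andP hu; have [v0 v1] := andP hv.
  have [C0v _ C1v _] := copula_grounded_margins hv.
  have [_ Cu0 _ _] := copula_grounded_margins hu.
  have [C00 _ C10 _] : [/\ _, _, _ & _] :=
    @copula_grounded_margins R 0 (introT andP (conj (lexx 0) ler01)).
  (* As [C] vanishes at height 0, the increment from height 0 to [v] is [C t v] itself: [t] from 0
     to [u] gives [0 <= C u v], from [u] to 1 gives [C u v <= v]. *)
  have := copula_section_nondecreasing (lexx (0 : R)) v0 v1 (lexx (0 : R)) u0 u1.
  have := copula_section_nondecreasing (lexx (0 : R)) v0 v1 u0 u1 (lexx (1 : R)).
  by rewrite C0v C1v Cu0 C00 C10 !subr0 => ? ?; apply/andP; split; lra.
- by move=> /copula_grounded_margins[_ ? _ _] /copula_grounded_margins[].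
- by move=> /copula_grounded_margins[_ _ _ ?] /copula_grounded_margins[].
- move=> /andP[u10 _] /andP[_ u21] /andP[v10 _] /andP[_ v21] u12 v12.
  have := copula_section_nondecreasing v10 (ltW v12) v21 u10 (ltW u12) u21.
  by lra.
Qed.
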